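(* Let $x=(u,z)\in V$ be a solution of $$b(x,\varphi)=-\tfrac{1}{\sqrt{\alpha}}(u_d,I\varphi_1)_W\quad\text{for all }\varphi=(\varphi_1,\varphi_2)\in V,$$ and let $x_h=(u_h,z_h)\in V_h$ be its approximation given by $$b(x_h,\varphi_h)=-\tfrac{1}{\sqrt{\alpha}}(u_d,I\varphi_{h,1})_W\quad\text{for all }\varphi_h=(\varphi_{h,1},\varphi_{h,2})\in V_h .$$ Then $$\|x-x_h\|\le \kappa_h\,\mu_h\inf_{v_h\in V_h}\|x-v_h\|,$$ where $$\kappa_h=\frac{1+2L}{1+L}\left(1+M\left(1+\frac{2M}{\sqrt{\alpha}}\right)\mu_h\right)\quad\text{with}\quad L=\frac{M}{\sqrt{\alpha}},$$ and $\mu_h$ is the quasi-best-approximation constant of the constraint discretization (defined in the context).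
   Context: Let $Q, W, V_1, V_2$ be real Hilbert spaces with norms $\|\cdot\|_Q,\|\cdot\|_W,\|\cdot\|_1,\|\cdot\|_2$; $\langle\cdot,\cdot\rangle_i$ denotes the duality pairing of $V_i^*$ and $V_i$. Let $a:V_1\times V_2\to\mathbb{R}$ be a bounded bilinear form such that, for all $v_1\in V_1$, if $a(v_1,v_2)=0$ for all $v_2\in V_2$, then $v_1=0$, and $\inf_{\|v_2\|_2=1}\sup_{\|v_1\|_1=1}a(v_1,v_2)>0$. The norm of $V_2$ is (after replacing it, if necessary, by an equivalent one) $$\|v_2\|_2=\sup_{\varphi_1\in V_1,\ \|\varphi_1\|_1=1}a(\varphi_1,v_2),$$ so that the continuity and inf-sup constants of $a$ are both $1$. Let $C:Q\to V_2^*$ and $I:V_1\to W$ be bounded linear operators with operator norms $M_C$ and $M_I$ (with respect to these norms), $C^*:V_2\to Q$ given by $(q,C^*v_2)_Q=\langle Cq,v_2\rangle_2$, and $M:=\max\{M_I,M_C\}$. Let $\alpha>0$, $u_d\in W$. Set $V:=V_1\times V_2$ with $\|v\|:=(\|v_1\|_1^2+\|v_2\|_2^2)^{1/2}$ and $$b(v,\varphi) := a(v_1,\varphi_2)+a(\varphi_1,v_2)+\tfrac{1}{\sqrt{\alpha}}\big[(C^*v_2,C^*\varphi_2)_Q-(Iv_1,I\varphi_1)_W\big],\quad v,\varphi\in V.$$ Let $V_{h,i}\subset V_i$, $i=1,2$, be finite-dimensional subspaces such that the restriction of $a$ to $V_{h,1}\times V_{h,2}$ is nondegenerate (no nonzero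 element of either space is annihilated by the whole other space), and $V_h:=V_{h,1}\times V_{h,2}$. The generalized Ritz projection $R_{h,1}:V_1\to V_{h,1}$ is given by $a(R_{h,1}v_1,\varphi_{h,2})=a(v_1,\varphi_{h,2})$ for all $\varphi_{h,2}\in V_{h,2}$. The quasi-best-approximation constant $\mu_h$ of the constraint discretization is the smallest number $\mu_h\ge1$ such that $\|v_1-R_{h,1}v_1\|_1\le\mu_h\inf_{v_{h,1}\in V_{h,1}}\|v_1-v_{h,1}\|_1$ for all $v_1\in V_1$. *)

(* Defs.v *)
From HB Require Import structures.
From mathcomp Require Import all_boot all_order all_algebra.
From mathcomp Require Import all_classical all_reals all_analysis.

Set Implicit Arguments.
Unset Strict Implicit.
Unset Printing Implicit Defensive.

Import Order.TTheory GRing.Theory Num.Theory.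
Import numFieldNormedType.Exports.

Local Open Scope classical_set_scope.
Local Open Scope ring_scope.

HB.mixin Record CompleteNormedModule_isHilbert (R : realType) V
    of CompleteNormedModule R V := {
  inner : {dot V for (@idfun R)} ;
  sqr_norm_inner : forall v : V, `|v| ^+ 2 = inner v v
}.

#[short(type="hilbertType")]
HB.structure Definition Hilbert (R : realType) :=
  {V of CompleteNormedModule_isHilbert R V & CompleteNormedModule R V}.

(* The norm of the codomain is an explicit argument [N], so that these also
   apply to operators with values in a dual space.  [opnorm N T] is the
   operator norm only when [T] is bounded: [sup] returns 0 on unbounded sets. *)
Definition bounded_operator (R : realType) (E : normedModType R) (F : Type)
    (N : F -> R) (T : E -> F) : Prop :=
  exists k : R, forall x, N (T x) <= k * `|x|.

Definition opnorm (R : realType) (E : normedModType R) (F : Type)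
    (N : F -> R) (T : E -> F) : R :=
  sup [set N (T x) | x in [set x : E | `|x| <= 1]].

Definition dual (R : realType) (E : normedModType R) : set (E -> R^o) :=
  [set f : E -> R^o | scalar f /\ continuous f].
Arguments dual {R} E.

Definition dual_norm (R : realType) (E : normedModType R) (f : E -> R^o) : R :=
  opnorm (fun r : R^o => `|r|) f.

Definition finite_dim_subspace (R : realType) (E : lmodType R) (S : set E) :
    Prop :=
  exists (n : nat) (e : 'I_n -> E),
    S = range (fun c : 'I_n -> R => \sum_(i < n) c i *: e i).

(* The Hilbert norm of the product: the library's norm on [V1 * V2] is the
   maximum norm. *)
Definition pair_norm (R : realType) (V1 V2 : normedModType R) (v : V1 * V2) :
    R :=
  Num.sqrt (`|v.1| ^+ 2 + `|v.2| ^+ 2).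

Definition opt_form (R : realType) (Q W V1 V2 : hilbertType R)
    (a : V1 -> V2 -> R) (Cstar : V2 -> Q) (I : V1 -> W) (alpha : R)
    (v phi : V1 * V2) : R :=
  a v.1 phi.2 + a phi.1 v.2
  + (Num.sqrt alpha)^-1
    * (inner (Cstar v.2) (Cstar phi.2) - inner (I v.1) (I phi.1)).

Definition ritz_projection (R : realType) (V1 V2 : normedModType R)
    (a : V1 -> V2 -> R) (Vh1 : set V1) (Vh2 : set V2) (P : V1 -> V1) : Prop :=
  forall v1, Vh1 (P v1) /\ forall ph2, Vh2 ph2 -> a (P v1) ph2 = a v1 ph2.

Definition quasi_best_bound (R : realType) (E : normedModType R)
    (S : set E) (P : E -> E) (mu : R) : Prop :=
  1 <= mu /\
  forall v, `|v - P v| <= mu * inf [set `|v - w| | w in S].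

Definition quasi_best_constant (R : realType) (E : normedModType R)
    (S : set E) (P : E -> E) (mu : R) : Prop :=
  quasi_best_bound S P mu /\
  forall nu, quasi_best_bound S P nu -> mu <= nu.

(* Main.v *)
(* Let [Rh2] be the Ritz projection of the second factor,
   rho = x - (Rh1 u, Rh2 z) and d = (Rh1 u, Rh2 z) - x_h.  Testing the error
   equations with d shows that E = (Cstar (z - z_h), I (u - u_h)) satisfies
   |E| <= M |rho|.  The same equations determine a(d.1, .) and a(., d.2) in
   terms of E, and as the norms are dual with respect to a,
   |d| <= alpha^(-1/2) M mu_h |E|, where mu_h bounds both Ritz projections
   because a projection in a Hilbert space and its complement share a norm
   bound.  Together with |rho| <= mu_h dist(x, Vh) this gives the constant
   (1 + alpha^(-1/2) M^2 mu_h) mu_h, which is at most kappa_h mu_h.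
   Duality of the norm of V1 follows from that of V2 and the injectivity of a,
   by two applications of the Riesz representation theorem. *)
Require Import Defs.
From HB Require Import structures.
From mathcomp Require Import all_boot all_order all_algebra.
From mathcomp Require Import all_classical all_reals all_analysis.
From mathcomp Require Import ring lra.

Import Order.TTheory GRing.Theory Num.Theory.
Import numFieldNormedType.Exports.

Local Open Scope classical_set_scope.
Local Open Scope ring_scope.

(** * Inner products and the Riesz representation theorem *)

Section InnerProduct.
Context {R : realType} {H : hilbertType R}.
Implicit Types u v w : H.

Lemma innerC u v : inner u v = inner v u.
Proof. by rewrite hermC /= expr0 mul1r. Qed.

Lemma innerPl (c : R) u v w : inner (c *: u + v) w = c * inner u w + inner v w.
Proof. by rewrite linearDl linearZl. Qed.

Lemma innerPr (c : R) u v w : inner w (c *: u + v) = c * inner w u + inner w v.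
Proof. by rewrite linearDr linearZr. Qed.

Lemma sqr_normP (c : R) u v :
  `|c *: u + v| ^+ 2 = c ^+ 2 * `|u| ^+ 2 + 2 * c * inner u v + `|v| ^+ 2.
Proof. by rewrite !sqr_norm_inner innerPl !innerPr (innerC v u); ring. Qed.

Lemma inner_le_norm u v : inner u v <= `|u| * `|v|.
Proof.
have [/eqP|v0] := eqVneq `|v| 0.
  by rewrite normr_eq0 => /eqP ->; rewrite linear0r normr0 mulr0.
have v_gt0 : 0 < `|v| by rewrite lt_def v0 normr_ge0.
have [/eqP|u0] := eqVneq `|u| 0.
  by rewrite normr_eq0 => /eqP ->; rewrite linear0l normr0 mul0r.
have u_gt0 : 0 < `|u| by rewrite lt_def u0 normr_ge0.
(* Rescaling [u] to the length of [v] turns this square into a positive multiple of the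
   Cauchy-Schwarz defect. *)
have := sqr_ge0 `|- (`|v| / `|u|) *: u + v|.
rewrite sqr_normP sqrrN => h.
have {}h : 0 <= 2 * (`|v| / `|u|) * (`|u| * `|v| - inner u v).
  apply: le_trans h _; rewrite le_eqVlt; apply/orP; left; apply/eqP.
  by field; rewrite u0.
by move: h; rewrite pmulr_rge0 ?subr_ge0// mulr_gt0// divr_gt0.
Qed.

Lemma normr_inner_le u v : `|inner u v| <= `|u| * `|v|.
Proof.
rewrite ler_norml inner_le_norm andbT lerNl -(normrN u) -linearNl.
exact: inner_le_norm.
Qed.

Lemma norm_le_inner (k : R) v :
  0 <= k -> inner v v <= k * `|v| -> `|v| <= k.
Proof.
move=> k0; rewrite -sqr_norm_inner expr2.
have [-> //|v0] := eqVneq `|v| 0.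
by rewrite ler_pM2r// lt_def v0 normr_ge0.
Qed.

Lemma inner_inj u v : (forall w, inner w u = inner w v) -> u = v.
Proof.
move=> uv; apply/eqP; rewrite -subr_eq0 -normr_eq0 -sqrf_eq0 sqr_norm_inner.
by rewrite linearBr /= uv subrr.
Qed.

(** Along the line [v + t w] the functional is quadratic in [t], and its minimum, at
    [t = - r / |w|^2], lies [r^2 / |w|^2] below the value at [v]. This drop is at most [d^2]. *)
Lemma riesz_almost_minimizer (f : H -> R) (m d : R) v : scalar f -> 0 <= d ->
    (forall w, m <= `|w| ^+ 2 - 2 * f w) ->
    `|v| ^+ 2 - 2 * f v <= m + d ^+ 2 ->
  forall w, `|inner v w - f w| <= d * `|w|.
Proof.
move=> lf d0 mf vm w.
have [/eqP|w0] := eqVneq `|w| 0.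
  have f0 : f 0 = 0 by have := lf (-1) 0 0; rewrite scaler0 addr0 mulN1r addNr.
  by rewrite normr_eq0 => /eqP ->; rewrite linear0r f0 subr0 !normr0 mulr0.
have w_gt0 : 0 < `|w| by rewrite lt_def w0 normr_ge0.
set r := inner v w - f w.
have := mf (- (r / `|w| ^+ 2) *: w + v).
rewrite sqr_normP lf => h.
have h2 : r ^+ 2 / `|w| ^+ 2 <= d ^+ 2.
  have -> : r ^+ 2 / `|w| ^+ 2 = - ((- (r / `|w| ^+ 2)) ^+ 2 * `|w| ^+ 2
      + 2 * - (r / `|w| ^+ 2) * inner w v - 2 * (- (r / `|w| ^+ 2) * f w)).
    by rewrite (innerC w v) /r; field.
  by lra.
rewrite ler_pdivrMr ?exprn_gt0// -exprMn -(real_normK (num_real r)) in h2.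
by rewrite -(@ler_pXn2r _ 2)// ?nnegrE// mulr_ge0.
Qed.

(** [F] is bounded below by completing the square. Its almost minimizers nearly represent [f];
    testing this with their differences makes them a Cauchy sequence, whose limit represents [f]
    exactly. *)
Lemma riesz_representation (f : H -> R) (k : R) : scalar f ->
  (forall v, `|f v| <= k * `|v|) -> exists g, forall v, inner v g = f v.
Proof.
move=> lf fk.
pose F v := `|v| ^+ 2 - 2 * f v.
have Flb : lbound (range F) (- k ^+ 2).
  move=> _ [v _ <-]; rewrite /F.
  have := fk v; rewrite ler_norml => /andP[_ fv].
  have := sqr_ge0 (`|v| - k); rewrite sqrrB => h.
  by rewrite lerBrDr; nra.
have Finf : has_inf (range F).
  by split; [exists (F 0); exists 0 | exists (- k ^+ 2)].
have mF w : inf (range F) <= F w.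
  by apply: ge_inf; [exists (- k ^+ 2)|exists w].
pose d n : R := n.+1%:R^-1.
have d_gt0 n : 0 < d n by rewrite invr_gt0 ltr0n.
have /choice[u uF] n : exists v, F v <= inf (range F) + d n ^+ 2.
  have [_ [v _ <-] Fv] := inf_adherent (exprn_gt0 2 (d_gt0 n)) Finf.
  by exists v; exact: ltW.
have ur n w : `|inner (u n) w - f w| <= d n * `|w|.
  exact: (riesz_almost_minimizer _ _ _ _ lf (ltW (d_gt0 n)) mF (uF n)).
have uu n p : `|u n - u p| <= d n + d p.
  apply: norm_le_inner; first by rewrite addr_ge0// ltW.
  have -> : inner (u n - u p) (u n - u p) =
      (inner (u n) (u n - u p) - f (u n - u p))
      - (inner (u p) (u n - u p) - f (u n - u p)).
    by rewrite linearBl; ring.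
  apply: le_trans (ler_norm _) _; apply: le_trans (ler_normB _ _) _.
  by rewrite mulrDl lerD.
have dlim (e : R) : 0 < e -> \forall n \near \oo, d n < e.
  by move=> e0; exact: near_infty_natSinv_lt (PosNum e0).
have /cauchy_cvgP/cvg_ex[g ug] : cauchy (u @ \oo).
  apply: cauchy_exP => e e0.
  have e20 : 0 < e / 2 by rewrite divr_gt0.
  have [N _ Nd] := dlim _ e20.
  exists (u N); exists N => // n /= Nn; rewrite -ball_normE /ball_ /=.
  apply: le_lt_trans (uu N n) _; rewrite (splitr e).
  by rewrite ltrD//; apply: Nd => /=.
exists g => w; apply/eqP; rewrite innerC -subr_eq0 -normr_le0.
apply/ler_addgt0Pr => e e0; rewrite add0r.
(* The summand 1 keeps the denominator positive when [w] is zero. *)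
pose c := e / (2 * (`|w| + 1)).
have w1 : 0 < `|w| + 1 by rewrite ltr_wpDl.
have c0 : 0 < c by rewrite divr_gt0// mulr_gt0.
have /filter_ex[n [gn dn]] : \forall n \near \oo, `|g - u n| <= c /\ d n <= c.
  near=> n; split; near: n.
    by move/cvgrPdist_le : ug => /(_ _ c0).
  by near do apply: ltW; exact: dlim.
have -> : inner g w - f w = inner (g - u n) w + (inner (u n) w - f w).
  by rewrite linearBl; ring.
apply: le_trans (ler_normD _ _) _.
have -> : e = c * (`|w| + 1) + c * (`|w| + 1).
  by rewrite /c; field; rewrite gt_eqF.
apply: lerD.
  apply: le_trans (normr_inner_le _ _) _.
  by rewrite ler_pM// lerDl.
apply: le_trans (ur n w) _.
by rewrite ler_pM// ?lerDl// ltW.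
Unshelve. all: by end_near. Qed.

End InnerProduct.

(* Here [u] and [w] are the two components of a vector under an oblique
   projection: swapping their lengths preserves the norm of the sum, so a bound
   on one component is a bound on the other. *)
Lemma complementary_norm_le {R : realType} {H : hilbertType R} (k : R)
    (u w : H) : 1 <= k ->
  (forall s t : R, `|t *: w| <= k * `|s *: u + t *: w|) ->
  `|u| <= k * `|u + w|.
Proof.
move=> k1 hk.
have [/eqP|w0] := eqVneq `|w| 0.
  by rewrite normr_eq0 => /eqP ->; rewrite addr0 ler_peMl.
have [->|u0] := eqVneq `|u| 0.
  by rewrite mulr_ge0// (le_trans _ k1).
have := hk (`|w| / `|u|) (`|u| / `|w|).
rewrite normrZ normf_div !normr_id divfK// => /le_trans; apply.
rewrite ler_pM2l ?(lt_le_trans _ k1)//.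
rewrite -(@ler_pXn2r _ 2)// ?nnegrE//.
rewrite sqr_normP [inner u _]linearZr normrZ normf_div !normr_id divfK//=.
have := sqr_normP 1 u w; rewrite scale1r => ->.
rewrite le_eqVlt; apply/orP; left; apply/eqP.
by field; rewrite u0 w0.
Qed.

(** * The isometry induced by [a], and duality of the two norms *)

Section DualityIsometry.
Context {R : realType} {V1 V2 : hilbertType R}.
Variable a : {bilinear V1 -> V2 -> R | *%R & *%R}.
Hypothesis a_bounded :
  exists k : R, forall v1 v2, `|a v1 v2| <= k * `|v1| * `|v2|.
Hypothesis a_inj : forall v1, (forall v2, a v1 v2 = 0) -> v1 = 0.
Hypothesis norm_V2 : forall v2 : V2,
  `|v2| = sup [set a phi1 v2 | phi1 in [set phi1 : V1 | `|phi1| = 1]].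

(** [T v2] is the Riesz representer of [a^~ v2]; if it is nonzero, the supremum in [norm_V2] is
    attained at its normalization. *)
Lemma bilinear_riesz : exists T : V2 -> V1,
  (forall v1 v2, inner v1 (T v2) = a v1 v2) /\ (forall v2, `|T v2| = `|v2|).
Proof.
have [k ak] := a_bounded.
have /choice[T aT] v2 : exists g, forall v1, inner v1 g = a v1 v2.
  apply: (riesz_representation (a^~ v2) (k * `|v2|)).
    by move=> c u v; rewrite linearDl linearZl.
  by move=> v; rewrite mulrAC.
exists T; split; first by move=> v1 v2; exact: aT.
move=> v2; apply/eqP; rewrite norm_V2 eq_le; apply/andP; split; last first.
  set A := (X in sup X).
  (* For trivial [V1] the unit sphere is empty and [sup] takes its default value 0. *)
  have [->|/set0P A0] := eqVneq A set0; first by rewrite sup0.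
  apply: ge_sup => // _ [u /= u1 <-].
  by rewrite -aT (le_trans (inner_le_norm _ _))// u1 mul1r.
have [T0|T0] := eqVneq `|T v2| 0; first by rewrite T0 -norm_V2.
apply: ub_le_sup.
  exists `|T v2| => _ [u /= u1 <-].
  by rewrite -aT (le_trans (inner_le_norm _ _))// u1 mul1r.
exists (`|T v2|^-1 *: T v2).
  by rewrite /= normrZ normfV normr_id mulVf.
by rewrite -aT linearZl /= -sqr_norm_inner expr2 mulKf.
Qed.

Lemma bilinear_le_norm v1 v2 : a v1 v2 <= `|v1| * `|v2|.
Proof.
have [T [aT nT]] := bilinear_riesz.
by rewrite -aT -nT inner_le_norm.
Qed.

Lemma norm2_le_bilinear (k : R) v2 : 0 <= k ->
  (forall v1, a v1 v2 <= k * `|v1|) -> `|v2| <= k.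
Proof.
have [T [aT nT]] := bilinear_riesz => k0 ak.
by rewrite -nT norm_le_inner// aT.
Qed.

(* The Riesz isometry [T : V2 -> V1] of [a] is onto: the representer [g] of
   [a v1] satisfies [a (v1 - T g) v2 = 0] for all [v2]. *)
Lemma norm1_le_bilinear (k : R) v1 : 0 <= k ->
  (forall v2, a v1 v2 <= k * `|v2|) -> `|v1| <= k.
Proof.
have [T [aT nT]] := bilinear_riesz => k0 ak.
have TP (c : R) u v : T (c *: u + v) = c *: T u + T v.
  by apply: inner_inj => w; rewrite innerPr !aT linearDr linearZr.
(* Polarization: a linear isometry preserves inner products. *)
have Tinner u v : inner (T u) (T v) = inner u v.
  have := sqr_normP 1 (T u) (T v); rewrite -TP !nT sqr_normP.
  by lra.
have [l al] := a_bounded.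
have [g ga] : exists g, forall v2, inner v2 g = a v1 v2.
  apply: (riesz_representation (a v1) (l * `|v1|)) => //.
  by move=> c u v; rewrite linearDr linearZr.
have <- : T g = v1.
  apply/eqP; rewrite -subr_eq0; apply/eqP; apply: a_inj => v2.
  by rewrite linearBl /= -ga -aT Tinner innerC subrr.
by rewrite norm_le_inner// aT; move: (ak g); rewrite -ga -aT -Tinner -nT.
Qed.

End DualityIsometry.

(** * Operator norms and dual norms *)

(** Carries bounds from the unit ball, over which [opnorm] is taken, to the whole space. Positive
    homogeneity covers linear functionals and norms of linear maps alike. *)
Lemma homogeneous_le_norm {R : realType} {E : normedModType R} (g : E -> R)
    (k : R) :
  (forall (c : R) x, 0 <= c -> g (c *: x) = c * g x) ->
  (forall x, `|x| <= 1 -> g x <= k) -> forall x, g x <= k * `|x|.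
Proof.
move=> gZ gk x.
have [x0|x0] := eqVneq `|x| 0.
  have /eqP -> : x == 0 by rewrite -normr_eq0 x0.
  by rewrite -(scale0r 0) gZ// mul0r scale0r normr0 mulr0.
have xx : x = `|x| *: (`|x|^-1 *: x) by rewrite scalerA divff// scale1r.
rewrite [in leLHS]xx gZ// mulrC ler_wpM2r//; apply: gk.
by rewrite normrZ normfV normr_id mulVf.
Qed.

Lemma le_opnorm {R : realType} {E : normedModType R} {F : Type} (N : F -> R)
    (T : E -> F) x :
  bounded_operator N T -> `|x| <= 1 -> N (T x) <= opnorm N T.
Proof.
move=> [k Tk] x1; apply: ub_le_sup; last by exists x.
(* The constant [k] may be negative, hence the absolute value. *)
exists `|k| => _ [y /= y1 <-].
rewrite (le_trans (Tk y))// (le_trans (ler_norm _))// normrM normr_id.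
by rewrite ler_piMr.
Qed.

Lemma dual_le_norm {R : realType} {E : normedModType R} (f : E -> R^o) v :
  dual E f -> f v <= dual_norm f * `|v|.
Proof.
move=> [lf cf].
pose F : {linear E -> R^o} :=
  HB.pack f (GRing.isLinear.Build R E R^o *:%R f lf).
have Fbd : bounded_operator (fun r : R^o => `|r|) f.
  (* Continuity yields boundedness, so that the supremum in [dual_norm] is a genuine one. *)
  have /linear_boundedP/filter_ex[r fr] :=
    @continuous_linear_bounded _ _ _ 0 F (cf 0).
  by exists r.
have fZ (c : R) x : f (c *: x) = c * f x by exact: (linearZ_LR F c x).
apply: (le_trans (ler_norm (f v : R))).
apply: (homogeneous_le_norm (fun v => `|f v : R|)).
  by move=> c x c0; rewrite fZ normrM ger0_norm.
by move=> x x1; exact: le_opnorm Fbd x1.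
Qed.

(** * Finite-dimensional subspaces and the discrete adjoint equation *)

Section FiniteDimensional.
Context {R : realType}.

Lemma finite_dim_subspaceP {E : lmodType R} (S : set E) (c : R) u v :
  finite_dim_subspace S -> S u -> S v -> S (c *: u + v).
Proof.
move=> [n [e ->]] [x _ <-] [y _ <-]; exists (fun i => c * x i + y i) => //.
rewrite scaler_sumr -big_split /=; apply: eq_bigr => i _.
by rewrite scalerDl scalerA.
Qed.

(* The linear system for [w] is consistent because every row relation of its
   matrix gives an element of [S1] annihilated by [S2], that is [0]. *)
Lemma adjoint_ritz_exists {V1 V2 : lmodType R}
    (a : {bilinear V1 -> V2 -> R | *%R & *%R}) (S1 : set V1) (S2 : set V2) v :
  finite_dim_subspace S1 -> finite_dim_subspace S2 ->
  (forall v1, S1 v1 -> (forall v2, S2 v2 -> a v1 v2 = 0) -> v1 = 0) ->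
  exists2 w, S2 w & forall p, S1 p -> a p w = a p v.
Proof.
move=> [n [e ->]] [m [f ->]] nondeg.
have sumP (r : 'rV[R]_n) (w : V2) :
    a (\sum_i r 0 i *: e i) w = (r *m \col_i a (e i) w) 0 0.
  rewrite linear_sumlz mxE; apply: eq_bigr => i _.
  by rewrite linearZl mxE.
pose A : 'M[R]_(m, n) := \matrix_(j, i) a (e i) (f j).
pose b : 'rV[R]_n := \row_i a (e i) v.
have /submxP[D bD] : (b <= A)%MS.
  rewrite submxE; apply/eqP/rowP => k; rewrite [RHS]mxE.
  pose r : 'rV[R]_n := (col k (cokermx A))^T.
  (* The [e i] span but may be dependent: the combination vanishes, not necessarily [r], and this is
     what evaluating [a] at [v] requires. *)
  have r0 : \sum_i r 0 i *: e i = 0.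
    apply: nondeg; first by exists (r 0).
    move=> _ [c _ <-]; rewrite linear_sumr big1//= => j _.
    rewrite linearZr sumP /=.
    have := congr1 (fun M : 'M[R]__ => M j k) (mulmx_coker A).
    rewrite !mxE => A0.
    apply/eqP; rewrite mulf_eq0; apply/orP; right; apply/eqP.
    by rewrite -[RHS]A0; apply: eq_bigr => i _; rewrite !mxE mulrC.
  transitivity (a (\sum_i r 0 i *: e i) v); last by rewrite r0 linear0l.
  by rewrite sumP !mxE; apply: eq_bigr => i _; rewrite !mxE mulrC.
exists (\sum_j D 0 j *: f j); first by exists (D 0).
move=> _ [c _ <-]; rewrite !linear_sumlz; apply: eq_bigr => i _.
rewrite !linearZl /=; congr (_ * _); rewrite linear_sumr.
have := congr1 (fun M : 'rV[R]_n => M 0 i) bD; rewrite !mxE => ->.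
by apply: eq_bigr => j _; rewrite linearZr /= mxE.
Qed.

End FiniteDimensional.

(** * The Hilbert norm on a product *)

Lemma pair_normE {R : realType} {V1 V2 : normedModType R} (v : V1 * V2) :
  pair_norm v ^+ 2 = `|v.1| ^+ 2 + `|v.2| ^+ 2.
Proof. by rewrite sqr_sqrtr// addr_ge0// sqr_ge0. Qed.

(** Four spaces occur because pairs in [V1 * V2] are compared with pairs in [Q * W]. *)
Lemma pair_norm_le_scale {R : realType} {V1 V2 W1 W2 : normedModType R}
    (k : R) (v : V1 * V2) (w : W1 * W2) :
  0 <= k -> `|v.1| <= k * `|w.1| -> `|v.2| <= k * `|w.2| ->
  pair_norm v <= k * pair_norm w.
Proof.
move=> k0 vw1 vw2; rewrite -(@ler_pXn2r _ 2)// ?nnegrE ?mulr_ge0// ?sqrtr_ge0//.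
by rewrite exprMn !pair_normE mulrDr -!exprMn lerD// lerXn2r// nnegrE ?mulr_ge0.
Qed.

Lemma pair_norm_CauchySchwarz {R : realType} {V1 V2 : normedModType R}
    (v w : V1 * V2) :
  `|v.1| * `|w.1| + `|v.2| * `|w.2| <= pair_norm v * pair_norm w.
Proof.
have v0 : 0 <= pair_norm v by exact: sqrtr_ge0.
have w0 : 0 <= pair_norm w by exact: sqrtr_ge0.
rewrite -(@ler_pXn2r _ 2)// ?nnegrE ?addr_ge0 ?mulr_ge0//.
rewrite exprMn !pair_normE -subr_ge0.
(* Lagrange's identity: the squared sides differ by exactly this square. *)
have := sqr_ge0 (`|v.1| * `|w.2| - `|v.2| * `|w.1|).
by congr (_ <= _); ring.
Qed.

Lemma pair_norm_le_add {R : realType} {V1 V2 : normedModType R}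
    (v w : V1 * V2) : pair_norm (v + w) <= pair_norm v + pair_norm w.
Proof.
have v0 : 0 <= pair_norm v by exact: sqrtr_ge0.
have w0 : 0 <= pair_norm w by exact: sqrtr_ge0.
rewrite -(@ler_pXn2r _ 2)// ?nnegrE ?addr_ge0// ?sqrtr_ge0//.
rewrite sqrrD !pair_normE /=.
have vw := pair_norm_CauchySchwarz v w.
have h1 : `|v.1 + w.1| ^+ 2 <= (`|v.1| + `|w.1|) ^+ 2.
  by rewrite lerXn2r ?nnegrE ?addr_ge0// ler_normD.
have h2 : `|v.2 + w.2| ^+ 2 <= (`|v.2| + `|w.2|) ^+ 2.
  by rewrite lerXn2r ?nnegrE ?addr_ge0// ler_normD.
apply: le_trans (lerD h1 h2) _; rewrite mulr2n.
by lra.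
Qed.

(** * Quasi-best approximation and stability of the Ritz projection *)

Lemma quasi_best_le {R : realType} {E : normedModType R} (S : set E)
    (P : E -> E) (mu : R) v w :
  quasi_best_bound S P mu -> S w -> `|v - P v| <= mu * `|v - w|.
Proof.
move=> [mu1 Pmu] Sw; apply: le_trans (Pmu v) _.
rewrite ler_wpM2l//; first by exact: le_trans mu1.
by apply: ge_inf; [exists 0 => _ [u _ <-]|exists w].
Qed.

(** Comparing with 0 bounds the complement of [P] by [mu]; [complementary_norm_le] transfers the
    bound to [P]. *)
Lemma ritz_projection_le {R : realType} {V1 V2 : hilbertType R}
    (a : {bilinear V1 -> V2 -> R | *%R & *%R}) (S1 : set V1) (S2 : set V2)
    (P : V1 -> V1) (mu : R) v :
  finite_dim_subspace S1 ->
  (forall v1, S1 v1 -> (forall v2, S2 v2 -> a v1 v2 = 0) -> v1 = 0) ->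
  ritz_projection a S1 S2 P -> quasi_best_bound S1 P mu ->
  `|P v| <= mu * `|v|.
Proof.
move=> fin1 nondeg ritz qb.
have S1P (c : R) u w : S1 u -> S1 w -> S1 (c *: u + w).
  exact: finite_dim_subspaceP.
have S10 : S1 0.
  have [S1Pv _] := ritz v.
  by rewrite -(addNr (P v)) -scaleN1r; exact: S1P.
(* Nondegeneracy makes the defining equations of [P] determine its values, which stands in for
   linearity when [P y] is computed below. *)
have PE u w : S1 w -> (forall p, S2 p -> a w p = a u p) -> P u = w.
  move=> S1w aw; have [S1Pu aPu] := ritz u.
  apply/eqP; rewrite -subr_eq0; apply/eqP/nondeg.
    by rewrite addrC -scaleN1r; exact: S1P.
  by move=> p S2p; rewrite linearBl /= aPu// aw// subrr.
have [S1Pv aPv] := ritz v.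
rewrite -[in leRHS](subrK (P v) v) addrC.
apply: complementary_norm_le; first by case: qb.
move=> s t; set y := (X in _ <= mu * `|X|).
have Py : P y = s *: P v.
  apply: PE; first by rewrite -[_ *: _]addr0; exact: S1P.
  move=> p S2p; rewrite /y linearDl !linearZl /= linearBl /= aPv//.
  by rewrite subrr mulr0 addr0.
have := quasi_best_le S1 P mu y 0 qb S10.
by rewrite subr0 Py /y [_ + t *: _]addrC addrK.
Qed.

(** * The error estimate for the optimality system *)

Theorem theorem3p2 (R : realType) (Q W V1 V2 : hilbertType R)
  (a : {bilinear V1 -> V2 -> R | *%R & *%R})
  (a_bounded : exists k : R, forall v1 v2, `|a v1 v2| <= k * `|v1| * `|v2|)
  (a_inj : forall v1, (forall v2, a v1 v2 = 0) -> v1 = 0)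
  (a_infsup :
    (0%:E < ereal_inf
       [set ereal_sup [set (a v1 v2)%:E | v1 in [set v1 : V1 | `|v1| = 1]]
       | v2 in [set v2 : V2 | `|v2| = 1]])%O)
  (norm_V2 : forall v2 : V2,
    `|v2| = sup [set a phi1 v2 | phi1 in [set phi1 : V1 | `|phi1| = 1]])
  (C : {linear Q -> (V2 -> R^o)})
  (C_dual : forall q, dual V2 (C q))
  (C_bounded : bounded_operator (@dual_norm _ V2) C)
  (I : {linear V1 -> W})
  (I_bounded : bounded_operator (fun w : W => `|w|) I)
  (Cstar : V2 -> Q)
  (Cstar_adjoint : forall q v2, inner q (Cstar v2) = C q v2)
  (alpha : R) (alpha_gt0 : 0 < alpha) (u_d : W)
  (Vh1 : set V1) (Vh2 : set V2)
  (Vh1_findim : finite_dim_subspace Vh1)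
  (Vh2_findim : finite_dim_subspace Vh2)
  (nondegl : forall v1, Vh1 v1 -> (forall v2, Vh2 v2 -> a v1 v2 = 0) -> v1 = 0)
  (nondegr : forall v2, Vh2 v2 -> (forall v1, Vh1 v1 -> a v1 v2 = 0) -> v2 = 0)
  (Rh1 : V1 -> V1) (Rh1_ritz : ritz_projection a Vh1 Vh2 Rh1)
  (mu_h : R) (mu_h_qbc : quasi_best_constant Vh1 Rh1 mu_h)
  (x : V1 * V2)
  (x_sol : forall phi : V1 * V2,
    opt_form a Cstar I alpha x phi = - (Num.sqrt alpha)^-1 * inner u_d (I phi.1))
  (x_h : V1 * V2) (x_h_in : (Vh1 `*` Vh2) x_h)
  (x_h_sol : forall phi_h : V1 * V2, (Vh1 `*` Vh2) phi_h ->
    opt_form a Cstar I alpha x_h phi_h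
    = - (Num.sqrt alpha)^-1 * inner u_d (I phi_h.1)) :
  let M_I := opnorm (fun w : W => `|w|) I in
  let M_C := opnorm (@dual_norm _ V2) C in
  let M := Num.max M_I M_C in
  let L := M / Num.sqrt alpha in
  let kappa_h :=
    (1 + 2 * L) / (1 + L) * (1 + M * (1 + 2 * M / Num.sqrt alpha) * mu_h) in
  pair_norm (x - x_h)
    <= kappa_h * mu_h * inf [set pair_norm (x - v_h) | v_h in Vh1 `*` Vh2].
Proof.
set M_I := opnorm (fun w : W => `|w|) I; set M_C := opnorm (@dual_norm _ V2) C.
pose M := Num.max M_I M_C; pose L := M / Num.sqrt alpha.
pose kappa_h :=
  (1 + 2 * L) / (1 + L) * (1 + M * (1 + 2 * M / Num.sqrt alpha) * mu_h).
change (pair_norm (x - x_h)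
  <= kappa_h * mu_h * inf [set pair_norm (x - v_h) | v_h in Vh1 `*` Vh2]).
have M_I0 : 0 <= M_I.
  have := le_opnorm (fun w : W => `|w|) I 0 I_bounded.
  by rewrite normr0 ler01 => /(_ isT); exact: le_trans.
have M0 : 0 <= M by rewrite le_max M_I0.
have IM v : `|I v| <= M * `|v|.
  apply: (homogeneous_le_norm (fun v => `|I v|)).
    by move=> c w c0; rewrite linearZ normrZ ger0_norm.
  move=> w w1; apply: (@le_trans _ _ M_I); last by rewrite le_max lexx.
  exact: (le_opnorm (fun w : W => `|w|) I w I_bounded).
have CM q v : C q v <= M * `|v| * `|q|.
  apply: (homogeneous_le_norm (fun q => C q v : R)).
    by move=> c p c0; rewrite linearZ.
  move=> p p1; apply: (le_trans (dual_le_norm (C p) v (C_dual p))).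
  rewrite ler_wpM2r//; apply: (@le_trans _ _ M_C).
    exact: (le_opnorm (@dual_norm _ V2) C p C_bounded).
  by rewrite le_max lexx orbT.
(* The adjoint relation is tested with [q = Cstar v]. *)
have CsM v : `|Cstar v| <= M * `|v|.
  by apply: norm_le_inner; [exact: mulr_ge0|rewrite Cstar_adjoint].
have CsP (c : R) u v : Cstar (c *: u + v) = c *: Cstar u + Cstar v.
  apply: inner_inj => q; rewrite innerPr !Cstar_adjoint.
  by have [lC _] := C_dual q; rewrite lC.
have CsD u v : Cstar (u + v) = Cstar u + Cstar v.
  by rewrite -[in LHS](scale1r u) CsP scale1r.
have CsB u v : Cstar (u - v) = Cstar u - Cstar v.
  by rewrite addrC -scaleN1r CsP scaleN1r addrC.
have [qb _] := mu_h_qbc.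
have mu1 : 1 <= mu_h by case: qb.
have mu0 : 0 <= mu_h by exact: le_trans mu1.
have RhM v : `|Rh1 v| <= mu_h * `|v|.
  exact: (ritz_projection_le a Vh1 Vh2 Rh1 mu_h v Vh1_findim nondegl).
have /choice[Rh2 Rh2P] v2 :
    exists w, Vh2 w /\ forall p, Vh1 p -> a p w = a p v2.
  have [w Sw aw] :=
    adjoint_ritz_exists a Vh1 Vh2 v2 Vh1_findim Vh2_findim nondegl.
  by exists w.
have Rh2_in v : Vh2 (Rh2 v) by have [] := Rh2P v.
have Rh2E v p : Vh1 p -> a p (Rh2 v) = a p v by have [_] := Rh2P v; apply.
have Rh1_in v : Vh1 (Rh1 v) by have [] := Rh1_ritz v.
have Rh1E v p : Vh2 p -> a (Rh1 v) p = a v p by have [_] := Rh1_ritz v; apply.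
have a_le := bilinear_le_norm a a_bounded norm_V2.
have norm2_le := norm2_le_bilinear a a_bounded norm_V2.
have norm1_le := norm1_le_bilinear a a_bounded a_inj norm_V2.
have sub1 u v : Vh1 u -> Vh1 v -> Vh1 (u - v).
  move=> Su Sv; rewrite addrC -scaleN1r.
  exact: (finite_dim_subspaceP Vh1 (-1) v u Vh1_findim).
have sub2 u v : Vh2 u -> Vh2 v -> Vh2 (u - v).
  move=> Su Sv; rewrite addrC -scaleN1r.
  exact: (finite_dim_subspaceP Vh2 (-1) v u Vh2_findim).
have zero1 : Vh1 0 by rewrite -(subrr (Rh1 0)); exact: sub1.
have zero2 : Vh2 0 by rewrite -(subrr (Rh2 0)); exact: sub2.
(* [Rh2] is the adjoint of [Rh1] with respect to [a], so norm duality passes the bound on. *)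
have Rh2M v : `|Rh2 v| <= mu_h * `|v|.
  apply: norm2_le; first by rewrite mulr_ge0.
  move=> p; rewrite -Rh1E// Rh2E//; apply: le_trans (a_le _ _) _.
  by rewrite mulrAC ler_wpM2r.
have Rh2_qb v w : Vh2 w -> `|v - Rh2 v| <= mu_h * `|v - w|.
  move=> Sw; apply: norm2_le; first by rewrite mulr_ge0.
  move=> p.
  (* Both Ritz errors annihilate discrete arguments, so [w] enters freely and [p] is replaced by its
     own error, of norm at most [mu_h] times that of [p]. *)
  have -> : a p (v - Rh2 v) = a (p - Rh1 p) (v - w).
    rewrite !linearBr /= !linearBl /= (Rh1E p w)// subrr subr0.
    by rewrite -(Rh1E p (Rh2 v))// Rh2E.
  apply: le_trans (a_le _ _) _; rewrite mulrAC ler_wpM2r//.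
  by have := quasi_best_le Vh1 Rh1 mu_h p 0 qb zero1; rewrite subr0.
move: x x_sol x_h x_h_in x_h_sol.
move=> [u z] x_sol [u_h z_h] [/= uh_in zh_in] xh_sol.
pose s := (Num.sqrt alpha)^-1.
have s_gt0 : 0 < s by rewrite invr_gt0 sqrtr_gt0.
have s0 := ltW s_gt0.
(* Galerkin orthogonality. The tests [(0, p)] and [(p, 0)] then split it into [gal1] and [gal2]. *)
have gal p1 p2 : Vh1 p1 -> Vh2 p2 ->
    a (u - u_h) p2 + a p1 (z - z_h)
    + s * (inner (Cstar (z - z_h)) (Cstar p2) - inner (I (u - u_h)) (I p1)) = 0.
  move=> S1 S2; have := x_sol (p1, p2); rewrite -xh_sol// /opt_form /= => h.
  rewrite CsB !linearBl linearBr linearB /= linearBl /=.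
  by move/eqP : h; rewrite -subr_eq0 => /eqP <-; rewrite /s; ring.
set e1 := u - u_h in gal; set e2 := z - z_h in gal.
have I0 : I 0 = 0 by rewrite linear0.
have Cs0 : Cstar 0 = 0 by rewrite -(subrr 0) CsB subrr.
have gal1 p : Vh2 p -> a e1 p = - s * inner (Cstar e2) (Cstar p).
  move=> Sp; have := gal 0 p zero1 Sp.
  by rewrite I0 linear0l linear0r; lra.
have gal2 p : Vh1 p -> a p e2 = s * inner (I e1) (I p).
  move=> Sp; have := gal p 0 Sp zero2.
  by rewrite Cs0 linear0r linear0r; lra.
pose rho : V1 * V2 := (u - Rh1 u, z - Rh2 z).
pose d : V1 * V2 := (Rh1 u - u_h, Rh2 z - z_h).
(* The order is crossed on purpose: [gal1] ties the first error to [Cstar e2], and [gal2] the second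
   to [I e1]. *)
pose E : Q * W := (Cstar e2, I e1).
have e1E : e1 = rho.1 + d.1 by rewrite /= addrA subrK.
have e2E : e2 = rho.2 + d.2 by rewrite /= addrA subrK.
have d1_in : Vh1 d.1 by exact: sub1.
have d2_in : Vh2 d.2 by exact: sub2.
have ad1 p : Vh2 p -> a d.1 p = a e1 p.
  by move=> Sp; rewrite /= !linearBl /= Rh1E.
have ad2 p : Vh1 p -> a p d.2 = a p e2.
  by move=> Sp; rewrite /= !linearBr /= Rh2E.
(* Testing the discrete error equations with [d] itself makes the two [a]-terms
   cancel, so that [E] is orthogonal to its own discrete part. *)
have E_rho : pair_norm E <= M * pair_norm rho.
  pose r : Q * W := (Cstar rho.2, I rho.1).
  have r_rho : pair_norm r <= M * pair_norm rho.
    have -> : pair_norm rho = pair_norm (rho.2, rho.1).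
      by rewrite /pair_norm addrC.
    by apply: pair_norm_le_scale => /=.
  apply: le_trans r_rho.
  have Er : pair_norm E ^+ 2 = inner E.1 r.1 + inner E.2 r.2.
    rewrite pair_normE !sqr_norm_inner.
    have -> : inner E.1 E.1 = inner E.1 r.1 + inner E.1 (Cstar d.2).
      by rewrite -linearDr -[r.1]/(Cstar rho.2) -CsD -e2E.
    have -> : inner E.2 E.2 = inner E.2 r.2 + inner E.2 (I d.1).
      by rewrite -linearDr -[r.2]/(I rho.1) -linearD -e1E.
    have := ad1 _ d2_in; rewrite gal1// ad2// gal2// mulNr -mulrN.
    by move=> /(mulfI (lt0r_neq0 s_gt0)) h; rewrite [inner E.2 (I d.1)]h; ring.
  have [->|E0] := eqVneq (pair_norm E) 0; first by rewrite sqrtr_ge0.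
  have E_gt0 : 0 < pair_norm E by rewrite lt_def E0 sqrtr_ge0.
  rewrite -(ler_pM2l E_gt0) -expr2 Er.
  apply: le_trans (pair_norm_CauchySchwarz E r).
  by rewrite lerD// inner_le_norm.
have d_E : pair_norm d <= s * M * mu_h * pair_norm E.
  apply: pair_norm_le_scale; first by rewrite !mulr_ge0.
    apply: norm1_le; first by rewrite !mulr_ge0.
    (* As [d.1] is discrete, [p] may be replaced by [Rh2 p], which [gal1] admits as a test; this
       costs the factor [mu_h]. *)
    move=> p; rewrite -Rh2E// ad1// gal1// mulNr -mulrN -linearNr.
    rewrite -!mulrA ler_wpM2l//; apply: le_trans (inner_le_norm _ _) _.
    rewrite normrN mulrC.
    rewrite [leRHS](_ : _ = M * (mu_h * `|p|) * `|Cstar e2|) /=; last by ring.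
    by rewrite ler_wpM2r// (le_trans (CsM _))// ler_wpM2l.
  apply: norm2_le; first by rewrite !mulr_ge0.
  move=> p; rewrite -Rh1E// ad2// gal2//.
  rewrite -!mulrA ler_wpM2l//; apply: le_trans (inner_le_norm _ _) _.
  rewrite mulrC.
  rewrite [leRHS](_ : _ = M * (mu_h * `|p|) * `|I e1|) /=; last by ring.
  by rewrite ler_wpM2r// (le_trans (IM _))// ler_wpM2l.
have rho_inf : pair_norm rho <= mu_h *
    inf [set pair_norm ((u, z) - v_h) | v_h in Vh1 `*` Vh2].
  rewrite -ler_pdivrMl ?(lt_le_trans _ mu1)//; apply: lb_le_inf.
    by exists (pair_norm ((u, z) - (0, 0))); exists (0, 0).
  move=> _ [[w1 w2] [/= Sw1 Sw2] <-].
  rewrite ler_pdivrMl ?(lt_le_trans _ mu1)//.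
  apply: pair_norm_le_scale => //=; last exact: Rh2_qb.
  exact: (quasi_best_le Vh1 Rh1 mu_h u w1 qb Sw1).
(* The fraction in [kappa_h] is at least 1, and the other factor exceeds the left side by
   [M * mu_h * (1 + s * M)]. *)
have kappa_ge : 1 + s * M * mu_h * M <= kappa_h.
  have L0 : 0 <= L by rewrite mulr_ge0.
  rewrite -[leLHS]mul1r; apply: ler_pM => //.
    by rewrite addr_ge0// !mulr_ge0.
    by rewrite ler_pdivlMr ?ltr_wpDr// mul1r; lra.
  rewrite lerD2l -/s -subr_ge0.
  rewrite [leRHS](_ : _ = M * mu_h * (1 + s * M)); last by rewrite /s; ring.
  by rewrite !mulr_ge0// addr_ge0// mulr_ge0.
have -> : (u, z) - (u_h, z_h) = rho + d.
  by rewrite -[LHS]/(e1, e2) e1E e2E.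
apply: le_trans (pair_norm_le_add _ _) _.
apply: (@le_trans _ _ ((1 + s * M * mu_h * M) * pair_norm rho)).
  rewrite mulrDl mul1r lerD2l -!mulrA.
  apply: le_trans d_E _.
  by rewrite -!mulrA !ler_wpM2l.
rewrite -[leRHS]mulrA; apply: ler_pM => //.
  by rewrite addr_ge0// !mulr_ge0.
exact: sqrtr_ge0.
Qed.
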